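(* Let $\Lambda$ be a finite dimensional algebra over an algebraically closed field and let $U$ be a $\tau$-rigid module in $\mathsf{mod}\,\Lambda$. For every nonnegative integer $n$, $\mathsf{cok}_n U$ is an $(n+1)$-fold torsion class of $\mathsf{mod}\,\Lambda$.
   Context: $\mathsf{mod}\,\Lambda$ is the category of finitely generated right $\Lambda$-modules; all subcategories are full and closed under isomorphisms. $\tau$ is the Auslander-Reiten translation; $U$ is $\tau$-rigid if $\mathrm{Hom}_\Lambda(U,\tau U)=0$. $\mathsf{add}\,U$ is the subcategory of finite direct sums of direct summands of $U$. $\mathsf{cok}_n U$ is the subcategory of all modules $C$ admitting an exact sequence $U_n\to U_{n-1}\to\cdots\to U_0\to C\to0$ with all $U_i\in\mathsf{add}\,U$. Let $\mathcal{E}$ be an extension-closed subcategory of an abelian category $\mathcal{A}$. A conflation in $\mathcal{E}$ is a short exact sequence of $\mathcal{A}$ with all three terms in $\mathcal{E}$. A subcategory $\mathcal{S}\subset\mathcal{E}$ is a torsion class of $\mathcal{E}$ if for every conflation $0\to A\to B\to C\to0$ in $\mathcal{E}$: $A,C\in\mathcal{S}$ implies $B\in\mathcal{S}$, and $B\in\mathcal{S}$ implies $C\in\mathcal{S}$. For $m\ge 0$, $\mathcal{X}$ is an $m$-fold torsion class of $\mathcal{A}$ if there are subcategories $\mathcal{T}_0=\mathcal{A},\mathcal{T}_1,\dots,\mathcal{T}_m=\mathcal{X}$ such that $\mathcal{T}_{i+1}$ is a torsion class of $\mathcal{T}_i$ for $0\le i\le m-1$. *)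

(* Defs.v *)
From HB Require Import structures.
From mathcomp Require Import all_boot all_order all_algebra all_field.
From mathcomp Require Import boolp.
Set Implicit Arguments.
Unset Strict Implicit.
Unset Printing Implicit Defensive.
Import GRing.Theory.
Local Open Scope ring_scope.

(* Right modules over Lambda are the left modules over the converse ring
   Lambda^c, i.e. the inhabitants of [lmodType Lambda^c], with m . a written
   a *: m.  The notions that do not involve the Auslander-Reiten translation
   are stated for [lmodType R] with R an arbitrary ring. *)

Section Modules.
Variable R : nzRingType.
Implicit Types A B C M N P U : lmodType R.

Definition fingen M :=
  exists (n : nat) (e : 'I_n -> M),
    forall x, exists c : 'I_n -> R, x = \sum_(i < n) c i *: e i.

Definition isomorphic M N := exists f : {linear M -> N}, bijective f.

Definition surjective M N (f : M -> N) := forall y, exists x, f x = y.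

Definition exact A B C (f : {linear A -> B}) (g : {linear B -> C}) :=
  forall y, g y = 0 <-> exists x, f x = y.

Definition short_exact A B C (f : {linear A -> B}) (g : {linear B -> C}) :=
  [/\ injective f, exact f g & surjective g].

Definition projective P :=
  forall M N (f : {linear M -> N}) (g : {linear P -> N}), surjective f ->
    exists h : {linear P -> M}, forall x, f (h x) = g x.

Definition superfluous M (L : {pred M}) :=
  forall X : {pred M}, GRing.submod_closed X ->
    (forall m, exists x l, [/\ x \in X, l \in L & m = x + l]) ->
    forall m, m \in X.

(* The condition on d says that its corestriction P1 -> ker p is a projective
   cover. *)
Definition minimal_projective_presentation M P0 P1
    (d : {linear P1 -> P0}) (p : {linear P0 -> M}) :=
  [/\ fingen P0 /\ projective P0,
      fingen P1 /\ projective P1,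
      exact d p /\ surjective p,
      superfluous [pred x | p x == 0]
    & superfluous [pred x | d x == 0]].

Definition direct_summand M U :=
  exists N, isomorphic (M * N)%type U.

Inductive in_add U : lmodType R -> Prop :=
| in_add_zero (Z : lmodType R) : (forall z : Z, z = 0) -> in_add U Z
| in_add_sum (X Y Z : lmodType R) :
    direct_summand X U -> in_add U Y -> isomorphic (X * Y)%type Z ->
    in_add U Z.

(* Only V 0, ..., V n and d 0, ..., d (n - 1) are constrained. *)
Definition cok (n : nat) U C :=
  fingen C /\
  exists (V : nat -> lmodType R) (d : forall i, {linear V i.+1 -> V i})
         (p : {linear V 0 -> C}),
    [/\ forall i, (i <= n)%N -> in_add U (V i),
        surjective p,
        (0 < n)%N -> exact (d 0%N) p
      & forall i, (i.+1 < n)%N -> exact (d i.+1) (d i)].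

(* Full subcategories of the category of finitely generated modules, closed
   under isomorphisms, given by their objects. *)
Definition subcategory (E : lmodType R -> Prop) :=
  (forall M, E M -> fingen M) /\
  (forall M N, isomorphic M N -> E M -> E N).

Definition extension_closed (E : lmodType R -> Prop) :=
  forall A B C (f : {linear A -> B}) (g : {linear B -> C}),
    fingen B -> short_exact f g -> E A -> E C -> E B.

Definition torsion_class (E S : lmodType R -> Prop) :=
  [/\ extension_closed E,
      forall M, S M -> E M
    & forall A B C (f : {linear A -> B}) (g : {linear B -> C}),
        short_exact f g -> E A -> E B -> E C ->
        (S A -> S C -> S B) /\ (S B -> S C)].

Definition fold_torsion_class (m : nat) (X : lmodType R -> Prop) :=
  exists T : nat -> lmodType R -> Prop,
    [/\ forall i, (i <= m)%N -> subcategory (T i),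
        forall M, T 0%N M <-> fingen M,
        forall M, T m M <-> X M
      & forall i, (i < m)%N -> torsion_class (T i) (T i.+1)].

End Modules.

Lemma linear_ext (K : nzRingType) (M N : lmodType K) (f g : {linear M -> N}) :
  f =1 g -> f = g.
Proof.
case: f g => [f cf] [g cg] /= fg.
have {}fg : f = g by apply/funext.
case: _ / fg in cg *.
case: cf cg => [[a] [b]] [[a'] [b']].
by rewrite (Prop_irrelevance a a') (Prop_irrelevance b b').
Qed.

Definition hom (K : nzRingType) (M N : lmodType K) := {linear M -> N}.

Section Hom.
Variables (K : nzRingType) (M N : lmodType K).
Implicit Types f g h : hom M N.

HB.instance Definition _ := gen_eqMixin (hom M N).
HB.instance Definition _ := gen_choiceMixin (hom M N).

Definition hom_zero : hom M N := \0 : {linear M -> N}.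
Definition hom_opp f : hom M N := \- f : {linear M -> N}.
Definition hom_add f g : hom M N := f \+ g : {linear M -> N}.

Fact hom_addA : associative hom_add.
Proof. by move=> f g h; apply: linear_ext => x /=; rewrite addrA. Qed.
Fact hom_addC : commutative hom_add.
Proof. by move=> f g; apply: linear_ext => x /=; rewrite addrC. Qed.
Fact hom_add0 : left_id hom_zero hom_add.
Proof. by move=> f; apply: linear_ext => x /=; rewrite add0r. Qed.
Fact hom_addN : left_inverse hom_zero hom_opp hom_add.
Proof. by move=> f; apply: linear_ext => x /=; rewrite addNr. Qed.

HB.instance Definition _ :=
  GRing.isZmodule.Build (hom M N) hom_addA hom_addC hom_add0 hom_addN.

End Hom.

(* The left module Hom_Lambda(P, Lambda) of a right module P, where
   (a f)(x) = a (f x); the regular right module is (Lambda^c)^o. *)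
Section RingDual.
Variable L : nzRingType.

Definition ring_dual (P : lmodType L^c) := hom P ((L^c)^o : lmodType L^c).

Section Module.
Variable P : lmodType L^c.
HB.instance Definition _ := GRing.Zmodule.on (ring_dual P).

Definition ring_dual_fun (a : L) (f : ring_dual P) (x : P) : (L^c)^o :=
  a * (f x : L).

Fact ring_dual_fun_linear a f : linear (ring_dual_fun a f).
Proof.
move=> c x y; rewrite /ring_dual_fun linearP.
have E (u v : L) : a * (u * c + v) = a * u * c + a * v.
  by rewrite mulrDr mulrA.
exact: E.
Qed.
HB.instance Definition _ a f :=
  GRing.isLinear.Build L^c P ((L^c)^o) *:%R (ring_dual_fun a f)
    (ring_dual_fun_linear a f).

Definition ring_dual_scale (a : L) (f : ring_dual P) : ring_dual P :=
  ring_dual_fun a f : {linear P -> (L^c)^o}.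

Fact ring_dual_scaleA a b f :
  ring_dual_scale a (ring_dual_scale b f) = ring_dual_scale (a * b) f.
Proof. by apply: linear_ext => x; apply: (@mulrA L). Qed.
Fact ring_dual_scale1 : left_id 1 ring_dual_scale.
Proof. by move=> f; apply: linear_ext => x; apply: (@mul1r L). Qed.
Fact ring_dual_scaleDr : right_distributive ring_dual_scale +%R.
Proof. by move=> a f g; apply: linear_ext => x; apply: (@mulrDr L). Qed.
Fact ring_dual_scaleDl f : {morph ring_dual_scale^~ f : a b / a + b}.
Proof. by move=> a b; apply: linear_ext => x; apply: (@mulrDl L). Qed.

HB.instance Definition _ :=
  GRing.Zmodule_isLmodule.Build L (ring_dual P)
    ring_dual_scaleA ring_dual_scale1 ring_dual_scaleDr ring_dual_scaleDl.
End Module.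

Variables (P Q : lmodType L^c) (d : {linear P -> Q}).

Definition ring_dual_map (h : ring_dual Q) : ring_dual P :=
  (h : {linear Q -> (L^c)^o}) \o d : {linear P -> (L^c)^o}.

Fact ring_dual_map_linear : linear ring_dual_map.
Proof. by move=> a f g; apply: linear_ext. Qed.
HB.instance Definition _ :=
  GRing.isLinear.Build L (ring_dual Q) (ring_dual P) *:%R ring_dual_map
    ring_dual_map_linear.

End RingDual.

Section FieldDual.
Variables (k : fieldType) (L : falgType k).

(* The k-space underlying a left L-module. *)
Definition kspace (T : lmodType L) : Type := T.

Section Module.
Variable T : lmodType L.
HB.instance Definition _ := GRing.Zmodule.on (kspace T).

Definition kspace_scale (c : k) (t : kspace T) : kspace T :=
  (c%:A : L) *: (t : T).

Fact kspace_scaleA a b t :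
  kspace_scale a (kspace_scale b t) = kspace_scale (a * b) t.
Proof. by rewrite /kspace_scale scalerA -scalerAl mul1r scalerA. Qed.
Fact kspace_scale1 : left_id 1 kspace_scale.
Proof. by move=> t; rewrite /kspace_scale !scale1r. Qed.
Fact kspace_scaleDr : right_distributive kspace_scale +%R.
Proof. by move=> a s t; apply: scalerDr. Qed.
Fact kspace_scaleDl t : {morph kspace_scale^~ t : a b / a + b}.
Proof. by move=> a b; rewrite /kspace_scale !scalerDl. Qed.
HB.instance Definition _ :=
  GRing.Zmodule_isLmodule.Build k (kspace T)
    kspace_scaleA kspace_scale1 kspace_scaleDr kspace_scaleDl.
End Module.

(* The right module D T = Hom_k(T, k), where (phi . a)(t) = phi (a t). *)
Definition field_dual (T : lmodType L) :=
  hom (kspace T : lmodType k) (k^o : lmodType k).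

Variable T : lmodType L.
HB.instance Definition _ := GRing.Zmodule.on (field_dual T).

Definition field_dual_fun (a : L) (phi : field_dual T) (t : kspace T) : k^o :=
  phi (a *: (t : T)).

Fact field_dual_fun_linear a phi : linear (field_dual_fun a phi).
Proof.
move=> c s t; rewrite /field_dual_fun -linearP; congr (phi _).
have E (x y : T) : a *: (c%:A *: x + y) = c%:A *: (a *: x) + a *: y.
  by rewrite scalerDr !scalerA -scalerAr -scalerAl mul1r mulr1.
exact: E.
Qed.
HB.instance Definition _ a phi :=
  GRing.isLinear.Build k (kspace T) (k^o) *:%R (field_dual_fun a phi)
    (field_dual_fun_linear a phi).

Definition field_dual_scale (a : L^c) (phi : field_dual T) : field_dual T :=
  field_dual_fun a phi : {linear kspace T -> k^o}.

Fact field_dual_scaleA a b phi :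
  field_dual_scale a (field_dual_scale b phi) = field_dual_scale (a * b) phi.
Proof.
apply: linear_ext => t /=; rewrite /field_dual_fun /= /field_dual_fun.
by rewrite scalerA.
Qed.
Fact field_dual_scale1 : left_id 1 field_dual_scale.
Proof.
by move=> phi; apply: linear_ext => t /=; rewrite /field_dual_fun scale1r.
Qed.
Fact field_dual_scaleDr : right_distributive field_dual_scale +%R.
Proof. by move=> a phi psi; apply: linear_ext. Qed.
Fact field_dual_scaleDl phi : {morph field_dual_scale^~ phi : a b / a + b}.
Proof.
move=> a b; apply: linear_ext => t /=; rewrite /field_dual_fun.
by rewrite scalerDl linearD.
Qed.
HB.instance Definition _ :=
  GRing.Zmodule_isLmodule.Build L^c (field_dual T)
    field_dual_scaleA field_dual_scale1 field_dual_scaleDr field_dual_scaleDl.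
End FieldDual.

Section AuslanderReiten.
Variables (k : fieldType) (L : falgType k).

(* T is the transpose Tr M: the cokernel of the map
   Hom(P0, L) -> Hom(P1, L) induced by a minimal projective presentation
   P1 -> P0 -> M -> 0. *)
Definition is_transpose (M : lmodType L^c) (T : lmodType L) :=
  exists (P0 P1 : lmodType L^c) (d : {linear P1 -> P0}) (p : {linear P0 -> M})
         (q : {linear ring_dual P1 -> T}),
    [/\ minimal_projective_presentation d p,
        exact (ring_dual_map d) q
      & surjective q].

(* tau = D Tr is determined up to isomorphism. *)
Definition is_tau (M N : lmodType L^c) :=
  exists T : lmodType L, is_transpose M T /\ isomorphic (field_dual T) N.

Definition tau_rigid (U : lmodType L^c) :=
  exists N : lmodType L^c,
    is_tau U N /\ forall (f : {linear U -> N}) (u : U), f u = 0.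

End AuslanderReiten.

(* Main.v *)
(* If Hom(U, tau U) = 0 then Hom(A, tau U) = 0 for every A in Fac U = cok_0 U.
   Since tau U = D Tr U, the space Hom(A, tau U) is dual to the cokernel of
   Hom(P0, A) -> Hom(P1, A), where P1 -> P0 -> U -> 0 is the presentation
   defining Tr U; the vanishing of that cokernel gives Ext^1(U, A) = 0.  The
   horseshoe construction then shows by induction on n that cok_n U is closed
   under extensions.  The chain witnessing the theorem is
   mod Lambda, cok_0 U, ..., cok_n U: if 0 -> A -> B -> C -> 0 has
   A in cok_n U and B = U_0 / K with K in cok_n U, then the kernel of
   U_0 -> B -> C is an extension of A by K, so C is in cok_(n+1) U. *)
Require Import Defs.
From HB Require Import structures.
From mathcomp Require Import all_boot all_order all_algebra all_field.
From mathcomp Require Import boolp.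
From mathcomp Require classical_sets.
Set Implicit Arguments.
Unset Strict Implicit.
Unset Printing Implicit Defensive.
Import GRing.Theory.
Local Open Scope ring_scope.

(** * Kernels as modules *)

Section Kernel.
Variables (R : nzRingType) (M N : lmodType R) (f : {linear M -> N}).

Definition kernel_pred := [pred x | f x == 0].

Fact kernel_submod_closed : GRing.submod_closed kernel_pred.
Proof.
split=> [|a x y]; rewrite !inE ?linear0 // => /eqP fx /eqP fy.
by rewrite linearP fx fy scaler0 addr0.
Qed.
HB.instance Definition _ :=
  GRing.isSubmodClosed.Build R M kernel_pred kernel_submod_closed.

Record kernel := Kernel { kernel_val :> M; _ : kernel_val \in kernel_pred }.

HB.instance Definition _ := [isSub for kernel_val].
HB.instance Definition _ := [Choice of kernel by <:].
HB.instance Definition _ := [SubChoice_isSubLmodule of kernel by <:].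

Definition kernel_inclusion : {linear kernel -> M} := (val : kernel -> M).

Lemma kernel_inclusion_inj : injective kernel_inclusion.
Proof. exact: val_inj. Qed.

Lemma exact_kernel : exact kernel_inclusion f.
Proof.
move=> y; split=> [/eqP fy | [x <-]]; first by exists (Kernel fy).
by apply/eqP; case: x.
Qed.

Lemma short_exact_kernel : surjective f -> short_exact kernel_inclusion f.
Proof.
by split; [exact: kernel_inclusion_inj | exact: exact_kernel |].
Qed.

End Kernel.

(** * Factorizations, the horseshoe construction and additive closure *)

Section LinearMaps.
Variable R : nzRingType.
Implicit Types A B C K L M N U V W X : lmodType R.

Definition mk_linear M N (f : M -> N) (f_linear : linear f) : {linear M -> N} :=
  HB.pack f (GRing.isLinear.Build R M N *:%R f f_linear).

Definition copair M N B (f : {linear M -> B}) (g : {linear N -> B}) :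
    {linear (M * N)%type -> B} :=
  (f \o fst) \+ (g \o snd).

Fact inl_linear M N : linear (fun x : M => (x, 0) : (M * N)%type).
Proof. by move=> a x y; congr pair; rewrite /= ?scaler0 ?addr0. Qed.

Definition inl_map M N : {linear M -> (M * N)%type} := mk_linear (@inl_linear M N).

Fact inr_linear M N : linear (fun y : N => (0, y) : (M * N)%type).
Proof. by move=> a x y; congr pair; rewrite /= ?scaler0 ?addr0. Qed.

Definition inr_map M N : {linear N -> (M * N)%type} := mk_linear (@inr_linear M N).

(** Two preimages under [q] differ by an element that [h] kills, so [h] composed with any
    set-theoretic section of [q] is linear. *)
Lemma factor_surj M N X (q : {linear M -> N}) (h : {linear M -> X}) :
  surjective q -> (forall m, q m = 0 -> h m = 0) ->
  exists h' : {linear N -> X}, forall m, h' (q m) = h m.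
Proof.
move=> q_surj h0; have [s qs] := choice q_surj.
have hs m : h (s (q m)) = h m.
  by apply/eqP; rewrite -subr_eq0 -linearB h0 // linearB /= qs subrr.
have hs_linear : linear (h \o s).
  by move=> a x y /=; rewrite -linearP -[RHS]hs linearP /= !qs.
by exists (mk_linear hs_linear); apply: hs.
Qed.

Lemma factor_inj A B M (f : {linear A -> B}) (h : {linear M -> B}) :
  injective f -> (forall m, exists a, f a = h m) ->
  exists h' : {linear M -> A}, forall m, f (h' m) = h m.
Proof.
move=> f_inj /choice[s fs].
have s_linear : linear s.
  by move=> a x y; apply: f_inj; rewrite linearP !fs linearP.
by exists (mk_linear s_linear); apply: fs.
Qed.

Lemma surjective_comp A B C (f : A -> B) (g : B -> C) :
  surjective f -> surjective g -> surjective (g \o f).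
Proof. by move=> fS gS z; have [y <-] := gS z; have [x <-] := fS y; exists x. Qed.

Lemma isomorphic_surj M N :
  isomorphic M N -> exists f : {linear M -> N}, surjective f.
Proof. by case=> f [g fK gK]; exists f => y; exists (g y). Qed.

Lemma isomorphic_inv M N :
  isomorphic M N ->
  exists (f : {linear M -> N}) (g : {linear N -> M}), cancel f g /\ cancel g f.
Proof.
case=> f [g fK gK]; have g_linear : linear g.
  by move=> a x y; apply: (can_inj fK); rewrite linearP !gK.
by exists f, (mk_linear g_linear).
Qed.

Lemma isomorphic_trans M N X :
  isomorphic M N -> isomorphic N X -> isomorphic M X.
Proof. by case=> f fB [g gB]; exists (g \o f); apply: bij_comp. Qed.

Lemma fingen_surj M N (f : {linear M -> N}) :
  surjective f -> fingen M -> fingen N.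
Proof.
move=> fS [n [e gen]]; exists n, (f \o e) => y.
have [x <-] := fS y; have [c ->] := gen x; exists c.
by rewrite linear_sum; apply: eq_bigr => i _; rewrite linearZ.
Qed.

Lemma fingen_prod M N : fingen M -> fingen N -> fingen (M * N)%type.
Proof.
move=> [m [e egen]] [n [f fgen]]; exists (m + n)%N.
exists (fun i => match split i with inl j => (e j, 0) | inr j => (0, f j) end).
move=> [x y]; have [a ->] := egen x; have [b ->] := fgen y.
exists (fun i => match split i with inl j => a j | inr j => b j end).
rewrite big_split_ord /=.
have -> : \sum_(i < m)
    match split (lshift n i) with inl j => a j | inr j => b j end *:
    match split (lshift n i) with inl j => (e j, 0) | inr j => (0, f j) end
  = (\sum_(i < m) a i *: e i, 0) :> (M * N)%type.
  rewrite (eq_bigr (fun i => inl_map M N (a i *: e i))) -?linear_sum // => i _.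
  by rewrite (unsplitK (inl i)) linearZ.
have -> : \sum_(i < n)
    match split (rshift m i) with inl j => a j | inr j => b j end *:
    match split (rshift m i) with inl j => (e j, 0) | inr j => (0, f j) end
  = (0, \sum_(i < n) b i *: f i) :> (M * N)%type.
  elim/big_rec2: _ => // i w t _ ->; rewrite (unsplitK (inr i)).
  by congr pair; rewrite /= ?scaler0 ?addr0.
by congr pair; rewrite /= ?addr0 ?add0r.
Qed.

(** After subtracting a suitable [h w], an element of [B] dies in [C] and hence comes from [A]. *)
Lemma copair_surj A B C V W (f : {linear A -> B}) (g : {linear B -> C})
    (p : {linear V -> A}) (q : {linear W -> C}) (h : {linear W -> B}) :
  short_exact f g -> surjective p -> surjective q -> (forall w, g (h w) = q w) ->
  surjective (copair (f \o p) h).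
Proof.
move=> [fI fg _] pS qS gh b; have [w qw] := qS (g b).
have [|a fa] := (fg (b - h w)).1; first by rewrite linearB /= gh qw subrr.
by have [v pv] := pS a; exists (v, w); rewrite /= pv fa subrK.
Qed.

(** This is the kernel row of the snake lemma for the covers [p], [copair (f \o p) h] and [q]. The
    lift [h] of [q] through [g] takes the place of projectivity of [W]. *)
Lemma horseshoe A B C V W K L (f : {linear A -> B}) (g : {linear B -> C})
    (i : {linear K -> V}) (p : {linear V -> A})
    (j : {linear L -> W}) (q : {linear W -> C}) (h : {linear W -> B}) :
  short_exact f g -> short_exact i p -> short_exact j q ->
  (forall w, g (h w) = q w) ->
  exists (u : {linear K -> kernel (copair (f \o p) h)})
         (v : {linear kernel (copair (f \o p) h) -> L}), short_exact u v.
Proof.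
move=> [fI fg _] [iI ip pS] [jI jq _] gh; set r := copair _ h.
have rE x : kernel_inclusion r x = ((val x).1, (val x).2).
  exact: surjective_pairing.
have [||u uE] := @factor_inj _ _ _ (kernel_inclusion r) (inl_map V W \o i).
- exact: kernel_inclusion_inj.
- move=> k; apply/exact_kernel => /=.
  by rewrite linear0 addr0 (ip _).2 ?linear0 //; exists k.
have r0 (x : kernel r) : f (p (val x).1) + h (val x).2 = 0.
  by apply/(@exact_kernel _ _ _ r); exists x.
have [||v vE] := @factor_inj _ _ _ j (snd \o kernel_inclusion r) => //.
- move=> x; apply/jq; rewrite -gh /= -[RHS](linear0 g) -(r0 x) linearD /=.
  by rewrite (fg (f _)).2 ?add0r //; exists (p (val x).1).
exists u, v; split.
- move=> k k' /(congr1 (kernel_inclusion r)); rewrite !uE /= => -[].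
  exact: iI.
- move=> y; split=> [vy | [k <-]].
    have y2 : (val y).2 = 0 by rewrite -[LHS]vE vy linear0.
    have [|k ik] := (ip (val y).1).1.
      by apply: fI; move: (r0 y); rewrite y2 !linear0 addr0.
    exists k; apply: (@kernel_inclusion_inj _ _ _ r).
    by rewrite uE rE y2 /= ik.
  by apply: jI; rewrite vE linear0 /=; have /= -> := congr1 snd (uE k).
(* The element [h (j l)] dies in [C], so it is [f (p x)] for some [x], and [(- x, j l)] is the
   preimage of [l] under [v]. *)
move=> l; have [|a fa] := (fg (h (j l))).1.
  by rewrite gh; apply/jq; exists l.
have [x px] := pS a.
have [|y yE] := (@exact_kernel _ _ _ r (- x, j l)).1.
  by rewrite /= linearN /= px linearN /= fa addNr.
by exists y; apply: jI; rewrite vE /=; have /= -> := congr1 snd yE.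
Qed.

(** The kernel of [g \o p] is the preimage under [p] of the image of [f]; [p] carries it onto a copy
    of [A], with kernel [K]. *)
Lemma kernel_comp A B C V K (f : {linear A -> B}) (g : {linear B -> C})
    (i : {linear K -> V}) (p : {linear V -> B}) :
  short_exact f g -> short_exact i p ->
  exists (u : {linear K -> kernel (g \o p)}) (v : {linear kernel (g \o p) -> A}),
    short_exact u v.
Proof.
move=> [fI fg gS] [iI ip pS]; set r := g \o p.
have [||u uE] := @factor_inj _ _ _ (kernel_inclusion r) i.
- exact: kernel_inclusion_inj.
- by move=> k; apply/exact_kernel; rewrite /= (ip _).2 ?linear0 //; exists k.
have [||v vE] := @factor_inj _ _ _ f (p \o kernel_inclusion r) => //.
  by move=> x; apply/fg/(@exact_kernel _ _ _ r); exists x.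
exists u, v; split.
- by move=> k k' /(congr1 (kernel_inclusion r)); rewrite !uE => /iI.
- move=> y; split=> [vy | [k <-]].
    have [|k ik] := (ip (kernel_inclusion r y)).1.
      by rewrite -[LHS]vE vy linear0.
    by exists k; apply: (@kernel_inclusion_inj _ _ _ r); rewrite uE ik.
  by apply: fI; rewrite vE linear0; apply/ip; exists k; rewrite -uE.
move=> a; have [x px] := pS (f a).
have [|y yE] := (@exact_kernel _ _ _ r x).1.
  by rewrite /= px; apply/fg; exists a.
by exists y; apply: fI; rewrite vE /= -px; congr (p _).
Qed.

Lemma in_add_iso U V W : isomorphic V W -> in_add U V -> in_add U W.
Proof.
move=> VW UV; case: UV VW => [Z Z0 | X Y Z XU UY XYZ] ZW.
  apply: in_add_zero => w; have [f [g [_ gK]]] := isomorphic_inv ZW.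
  by rewrite -(gK w) (Z0 (g w)) linear0.
exact: in_add_sum XU UY (isomorphic_trans XYZ ZW).
Qed.

Lemma in_add_prod U V W : in_add U V -> in_add U W -> in_add U (V * W)%type.
Proof.
move=> UV UW; elim: UV => {V} [Z Z0 | X Y Z XU _ IH XYZ].
  apply: in_add_iso UW; exists (inr_map Z W); exists snd => [w | [z w]] /=; [by [] |].
  by rewrite (Z0 z).
apply: in_add_sum XU IH _.
have [f [g [fK gK]]] := isomorphic_inv XYZ.
(* The map regroups X * (Y * W) as (X * Y) * W and then applies [f] to X * Y. *)
have h_linear : linear
    (fun t : (X * (Y * W))%type => (f (t.1, t.2.1), t.2.2) : (Z * W)%type).
  move=> a x y; rewrite [RHS]surjective_pairing; congr pair.
  exact: (linearP f a (x.1, x.2.1) (y.1, y.2.1)).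
exists (mk_linear h_linear).
exists (fun t => ((g t.1).1, ((g t.1).2, t.2))) => /= [[x [y w]] | [z w]] /=.
  by rewrite fK.
by rewrite -surjective_pairing gK.
Qed.

Lemma direct_summand_retract X U :
  direct_summand X U ->
  exists (i : {linear X -> U}) (r : {linear U -> X}), cancel i r.
Proof.
case=> N /isomorphic_inv[f [g [fK gK]]].
by exists (f \o inl_map X N), (fst \o g) => x /=; rewrite fK.
Qed.

Lemma fingen_in_add U V : fingen U -> in_add U V -> fingen V.
Proof.
move=> Ufg; elim=> {V} [Z Z0 | X Y Z XU _ Yfg XYZ].
  exists 0%N, (fun=> 0) => x; exists (fun=> 0); by rewrite big_ord0.
have [f fS] := isomorphic_surj XYZ; apply: fingen_surj fS _.
apply: fingen_prod Yfg; have [i [r ir]] := direct_summand_retract XU.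
by apply: fingen_surj Ufg => x; exists (i x).
Qed.

End LinearMaps.

(** * The chain of the categories cok_n U *)

Section Cokernels.
Variables (R : nzRingType) (U : lmodType R).
Implicit Types A B C K L M N V W : lmodType R.
Hypothesis U_fingen : fingen U.

Lemma cok0P C :
  cok 0 U C <->
  exists (V : lmodType R) (p : {linear V -> C}), in_add U V /\ surjective p.
Proof.
split=> [[_ [V [d [p [UV pS _ _]]]]] | [V [p [UV pS]]]].
  by exists (V 0%N), p; split=> //; apply: UV.
split; first exact: fingen_surj pS (fingen_in_add U_fingen UV).
(* For n = 0 no exactness is required of the differentials, so zero maps serve as fillers. *)
by exists (fun=> V), (fun=> \0), p; split.
Qed.

(** This recursion through the first syzygy lets later proofs induct on [n] without handling whole
    sequences. *)
Lemma cokS n C :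
  cok n.+1 U C <->
  exists (K V : lmodType R) (f : {linear K -> V}) (p : {linear V -> C}),
    [/\ cok n U K, in_add U V & short_exact f p].
Proof.
split=> [[_ [V [d [p [UV pS dp dd]]]]] | [K [V [f [p [[_ cK] UV [fI fp pS]]]]]]].
  have {}dp := dp (ltn0Sn n).
  (* The map [d 0] corestricts to a surjection [q] onto the kernel of [p], and the sequence shifted
     by one place then presents that kernel. *)
  exists (kernel p), (V 0%N), (kernel_inclusion p), p.
  split; [|exact: UV|exact: short_exact_kernel].
  have [||q dq] := @factor_inj _ _ _ _ (kernel_inclusion p) (d 0%N).
  - exact: kernel_inclusion_inj.
  - by move=> m; apply/exact_kernel/dp; exists m.
  have qS : surjective q.
    move=> x; have [|y dy] := (dp (kernel_inclusion p x)).1.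
      by apply/exact_kernel; exists x.
    by exists y; apply: (@kernel_inclusion_inj _ _ _ p); rewrite dq.
  split; first exact: fingen_surj qS (fingen_in_add U_fingen (UV 1%N _)).
  exists (fun i => V i.+1), (fun i => d i.+1), q; split=> //.
  - by move=> i le_in; apply: UV.
  - move=> n_gt0 y; rewrite -(dd 0%N n_gt0) -dq; split=> [->|]; rewrite ?linear0 //.
    by move=> q0; apply: (@kernel_inclusion_inj _ _ _ p); rewrite q0 linear0.
  - by move=> i lt_in; apply: dd.
split; first exact: fingen_surj pS (fingen_in_add U_fingen UV).
have [V' [d [q [UV' qS dq dd]]]] := cK.
(* Splicing: [V] is inserted at place 0 and [f \o q] becomes the first differential. *)
pose V1 i := if i is j.+1 then V' j else V.
pose d1 i : {linear V1 i.+1 -> V1 i} :=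
  match i with 0%N => f \o q | j.+1 => d j end.
exists V1, d1, p; split=> //.
- by case=> [|i] //= le_in; apply: UV'.
- move=> _ y; rewrite fp; split=> [[x <-]|[x <-]] /=; last by exists (q x).
  by have [z <-] := qS x; exists z.
case=> [|i] lt_in; last exact: dd.
move=> y /=; rewrite -(dq lt_in); split=> [|->]; rewrite ?linear0 //.
by rewrite -(linear0 f) => /fI.
Qed.

Lemma cok_fingen n C : cok n U C -> fingen C.
Proof. by case. Qed.

Lemma cok_iso n M N : isomorphic M N -> cok n U M -> cok n U N.
Proof.
move=> /isomorphic_inv[f [g [fK gK]]]; case: n => [|n].
  move=> /cok0P[V [p [UV pS]]]; apply/cok0P; exists V, (f \o p); split=> //.
  by apply: surjective_comp => // y; exists (g y).
move=> /cokS[K [V [i [p [cK UV [iI ip pS]]]]]]; apply/cokS.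
exists K, V, i, (f \o p); split=> //; split=> // [y|].
  by rewrite -ip /=; split=> [/(congr1 g)|->]; rewrite ?fK ?linear0.
by apply: surjective_comp => // y; exists (g y).
Qed.

(** The leftmost term of the sequence is forgotten. This gives the inclusions in the chain of
    torsion classes. *)
Lemma cok_pred n C : cok n.+1 U C -> cok n U C.
Proof.
elim: n C => [|n IH] C /cokS[K [V [f [p [cK UV fp]]]]].
  by apply/cok0P; exists V, p; split=> //; case: fp.
by apply/cokS; exists K, V, f, p; split=> //; apply: IH.
Qed.

Lemma cok_cok0 n C : cok n U C -> cok 0 U C.
Proof. by elim: n => // n IH /cok_pred. Qed.

Lemma hom_cok0_eq0 A N :
  (forall (f : {linear U -> N}) u, f u = 0) -> cok 0 U A ->
  forall (f : {linear A -> N}) a, f a = 0.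
Proof.
move=> homU0 /cok0P[V [p [UV pS]]] f a; have [v <-] := pS a.
(* As [p] is surjective, [f] vanishes once [f \o p] does. This reduces the claim to add U, whose
   objects are built from retracts of [U]. *)
suff homV0 (h : {linear V -> N}) : forall x, h x = 0 by exact: (homV0 (f \o p)).
elim: UV h {f p pS a v} => {V} [Z Z0 f z|].
  by rewrite (Z0 z) linear0.
move=> X Y Z XU _ IH XYZ f z; have [i [r ir]] := direct_summand_retract XU.
have [s [t [_ tK]]] := isomorphic_inv XYZ.
rewrite -(tK z); case: (t z) => x y.
have -> : (x, y) = inl_map X Y x + inr_map X Y y.
  by congr pair; rewrite /= ?addr0 ?add0r.
have fx0 : f (s (inl_map X Y x)) = 0.
  by rewrite -(ir x); apply: (homU0 (f \o s \o inl_map X Y \o r)).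
rewrite !linearD fx0 add0r; exact: (IH (f \o s \o inr_map X Y)).
Qed.

(* This says Ext^1(U, Fac U) = 0. *)
Hypothesis lift_fac : forall A B C (f : {linear A -> B}) (g : {linear B -> C}),
  short_exact f g -> cok 0 U A ->
  forall h : {linear U -> C}, exists h' : {linear U -> B}, forall u, g (h' u) = h u.

(** On a summand [X] of [U] the map is extended to [U] along the retraction [r], lifted there, and
    restricted back along [i]. *)
Lemma lift_in_add V A B C (f : {linear A -> B}) (g : {linear B -> C}) :
  in_add U V -> short_exact f g -> cok 0 U A ->
  forall h : {linear V -> C}, exists h' : {linear V -> B}, forall v, g (h' v) = h v.
Proof.
move=> UV fg cA; elim: UV => {V} [Z Z0 | X Y Z XU _ IH XYZ] h.
  by exists \0 => z; rewrite (Z0 z) !linear0.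
have [i [r ir]] := direct_summand_retract XU.
have [s [t [sK tK]]] := isomorphic_inv XYZ.
have [h1 gh1] := lift_fac fg cA (h \o s \o inl_map X Y \o r).
have [h2 gh2] := IH (h \o s \o inr_map X Y).
exists (copair (h1 \o i) h2 \o t) => z /=.
rewrite linearD /= gh1 gh2 /= ir -linearD -linearD -[in RHS](tK z).
congr (h (s _)); case: (t z) => x y.
by congr pair; rewrite /= ?addr0 ?add0r.
Qed.

(** Since [A] lies in Fac U, the cover of [C] lifts to [B]. The horseshoe then makes the kernel of
    the cover of [B] an extension of [L] by [K], to which induction applies. *)
Lemma cok_extension n A B C (f : {linear A -> B}) (g : {linear B -> C}) :
  short_exact f g -> cok n U A -> cok n U C -> cok n U B.
Proof.
elim: n A B C f g => [|n IH] A B C f g fg cA.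
  move: (cA) => /cok0P[V [p [UV pS]]] /cok0P[W [q [UW qS]]].
  have [h gh] := lift_in_add UW fg cA q.
  apply/cok0P; exists (V * W)%type, (copair (f \o p) h).
  by split; [exact: in_add_prod | exact: copair_surj fg _ qS gh].
move: (cA) => /cokS[K [V [i [p [cK UV ip]]]]] /cokS[L [W [j [q [cL UW jq]]]]].
have [h gh] := lift_in_add UW fg (cok_cok0 cA) q.
have [u [v uv]] := horseshoe fg ip jq gh.
apply/cokS; exists (kernel (copair (f \o p) h)), (V * W)%type.
exists (kernel_inclusion _), (copair (f \o p) h).
split; [exact: IH uv cK cL | exact: in_add_prod |].
by case: ip jq => _ _ pS [_ _ qS]; apply/short_exact_kernel/(copair_surj fg pS qS gh).
Qed.

(** The module [A] itself, not a syzygy of it, enters the kernel of V -> C. Membership of [A] in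
    cok_n is therefore the right condition, and a conflation inside cok_n supplies it. *)
Lemma cok_quotient n A B C (f : {linear A -> B}) (g : {linear B -> C}) :
  short_exact f g -> cok n U A -> cok n.+1 U B -> cok n.+1 U C.
Proof.
move=> fg cA /cokS[K [V [i [p [cK UV ip]]]]]; apply/cokS.
have [u [v uv]] := kernel_comp fg ip.
exists (kernel (g \o p)), V, (kernel_inclusion _), (g \o p); split=> //.
  exact: cok_extension uv cK cA.
by case: fg ip => _ _ gS [_ _ pS]; apply/short_exact_kernel/(surjective_comp pS gS).
Qed.

Lemma cok_fold_torsion_class n : fold_torsion_class n.+1 (cok n U).
Proof.
(* Place 0 is the whole category of finitely generated modules, so cok_j sits at place j + 1. *)
exists (fun i => if i is j.+1 then cok j U else @fingen R).
split=> // [[|i] _ | [|i] _].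
- split=> // M N /isomorphic_surj[f fS]; exact: fingen_surj fS.
- by split; [exact: cok_fingen | exact: cok_iso].
(* The ambient category is extension-closed at once, because [extension_closed] takes the middle
   term to be finitely generated. *)
- split=> // [|A B C f g fg fA fB fC]; first exact: cok_fingen.
  split; first exact: cok_extension fg.
  case/cok0P=> V [p [UV pS]]; apply/cok0P; exists V, (g \o p); split=> //.
  by apply: surjective_comp => //; case: fg.
split; [|exact: cok_pred|move=> A B C f g fg cA _ _].
  by move=> A B C f g _; apply: cok_extension.
by split; [exact: cok_extension fg | exact: cok_quotient fg cA].
Qed.

End Cokernels.

(** * Separating functionals and dual bases *)

(** A maximal subspace [H] that contains [W] and avoids [v] is a complement of the line through [v];
    [xi] is the coordinate along [v]. *)
Lemma separating_functional (k : fieldType) (V : lmodType k) (W : V -> Prop) v :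
  W 0 -> (forall a x y, W x -> W y -> W (a *: x + y)) -> ~ W v ->
  exists xi : {linear V -> k^o}, (forall w, W w -> xi w = 0) /\ xi v <> 0.
Proof.
move=> W0 WP Wv.
(* Zorn is applied to W \/ X rather than X so that the empty chain has an
   upper bound. *)
pose ext (X : V -> Prop) x := W x \/ X x.
pose P (X : V -> Prop) :=
  (forall a x y, ext X x -> ext X y -> ext X (a *: x + y)) /\ ~ ext X v.
have [F FP chainF | H0 [[HP Hv] Hmax]] := @classical_sets.Zorn_bigcup V P.
  split=> [a x y | [//| [X FX Xv]]]; last by case: (FP _ FX) => _; apply; right.
  move=> [Wx | [X FX Xx]] [Wy | [Y FY Yy]]; first by left; apply: WP.
  - have [/(_ a x y) []] := FP _ FY; [by left|by right|by left|].
    by right; exists Y.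
  - have [/(_ a x y) []] := FP _ FX; [by right|by left|by left|].
    by right; exists X.
  have [Z [FZ Zx Zy]] : exists Z, [/\ F Z, Z x & Z y].
    have [XY | YX] := chainF _ _ FX FY.
      by exists Y; split=> //; apply: XY.
    by exists X; split=> //; apply: YX.
  have [/(_ a x y) []] := FP _ FZ; [by right|by right|by left|].
  by right; exists Z.
set H := ext H0 in HP Hv.
have H_0 : H 0 by left.
have HZ a x : H x -> H (a *: x) by move=> Hx; rewrite -[_ *: _]addr0; apply: HP.
have HB x y : H x -> H y -> H (x - y).
  by move=> Hx Hy; rewrite addrC -scaleN1r; apply: HP.
have split_x x : exists c : k, H (x - c *: v).
  have [Hx | nHx] := pselect (H x).
    by exists 0; rewrite scale0r subr0.
  (* [H1] is H + k x. By maximality of [H] it contains [v], with a nonzero coefficient at [x]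
     because [v] is not in [H]; so [x] can be solved for. *)
  pose H1 y := exists c : k, H (y - c *: x).
  have HH1 y : H y -> H1 y by exists 0; rewrite scale0r subr0.
  have extH1 y : ext H1 y <-> H1 y by split=> [[Wy|//] | ]; [apply/HH1; left | right].
  have [[c Hvc] | nH1v] := pselect (H1 v).
    have c0 : c != 0.
      by apply/eqP=> c0; apply: Hv; move: Hvc; rewrite c0 scale0r subr0.
    exists c^-1; suff -> : x - c^-1 *: v = - c^-1 *: (v - c *: x) by apply: HZ.
    by rewrite scalerBr !scaleNr scalerA mulVf // scale1r opprK addrC.
  case: (Hmax H1); last first.
    split=> [a y z /extH1[c Hy] /extH1[d Hz] | /extH1//].
    apply/extH1; exists (a * c + d).
    suff -> : a *: y + z - (a * c + d) *: x = a *: (y - c *: x) + (z - d *: x).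
      exact: HP.
    by rewrite scalerDl scalerBr scalerA opprD addrACA.
  split=> [y Hy | H10]; first by apply: HH1; right.
  by apply: nHx; right; apply: H10; exists 1; rewrite scale1r subrr.
have uniq_c c d : H ((c - d) *: v) -> c = d.
  move=> Hcd; apply/eqP; rewrite -subr_eq0; apply/eqP/eqP/negPn/negP => cd0.
  by apply: Hv; rewrite -[v]scale1r -(mulVf cd0) -scalerA; apply: HZ.
have [xi xiP] := choice split_x.
have xi_linear : linear (xi : V -> k^o).
  move=> a x y; apply: uniq_c.
  suff -> : (xi (a *: x + y) - (a *: (xi x : k^o) + xi y)) *: v =
      a *: (x - xi x *: v) + (y - xi y *: v) - (a *: x + y - xi (a *: x + y) *: v).
    by apply: HB => //; apply: HP.
  rewrite [in RHS]opprB scalerBl scalerDl scalerBr scalerA.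
  by rewrite [X in _ = X + _]addrACA -opprD [RHS]addrC addrA subrK.
exists (mk_linear xi_linear); split=> [w Ww | /= xv0].
  apply: uniq_c; rewrite subr0.
  suff -> : xi w *: v = w - (w - xi w *: v) by apply: HB => //; left.
  by rewrite opprB addrC subrK.
by apply: Hv; move: (xiP v); rewrite xv0 scale0r subr0.
Qed.

(** Projectivity splits the surjection R^n -> P given by generators, and the coordinates of the
    splitting are the functionals [e']. *)
Lemma dual_basis (R : nzRingType) (P : lmodType R) :
  fingen P -> projective P ->
  exists (n : nat) (e : 'I_n -> P) (e' : 'I_n -> {linear P -> R^o}),
    forall x, x = \sum_(i < n) (e' i x : R) *: e i.
Proof.
move=> [n [e gen]] Pproj.
have pi_linear : linear (fun c : {ffun 'I_n -> R^o} => \sum_(i < n) (c i : R) *: e i).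
  move=> a x y; rewrite scaler_sumr -big_split /=; apply: eq_bigr => i _.
  by rewrite !ffunE scalerDl scalerA.
have [|h hP] := Pproj _ _ (mk_linear pi_linear) idfun.
  move=> x; have [c ->] := gen x; exists (finfun c) => /=.
  by apply: eq_bigr => i _; rewrite ffunE.
have h_linear i : linear (fun x => h x i : R^o).
  by move=> a x y; rewrite linearP !ffunE.
by exists n, e, (fun i => mk_linear (h_linear i)) => x; rewrite -[LHS]hP.
Qed.

(** * The k-space underlying a right module *)

Section RightSpace.
Variables (k : fieldType) (L : falgType k).

(** An alias of [M], so that the action of [k] stays apart from that of [L^c]. *)
Definition right_kspace (M : lmodType L^c) : Type := M.

Variable M : lmodType L^c.
HB.instance Definition _ := GRing.Zmodule.on (right_kspace M).

Definition right_kspace_scale (c : k) (m : right_kspace M) : right_kspace M :=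
  ((c%:A : L) : L^c) *: (m : M).

Fact right_kspace_scaleA a b m :
  right_kspace_scale a (right_kspace_scale b m) = right_kspace_scale (a * b) m.
Proof.
rewrite /right_kspace_scale scalerA; congr (_ *: (m : M)).
(* Multiplication in [L^c] reverses the factors, hence [b] before [a] in [L]. *)
have E : (b%:A : L) * a%:A = (a * b)%:A.
  by rewrite -scalerAr mulr1 scalerA.
exact: E.
Qed.
Fact right_kspace_scale1 : left_id 1 right_kspace_scale.
Proof. by move=> m; rewrite /right_kspace_scale scale1r; apply: scale1r. Qed.
Fact right_kspace_scaleDr : right_distributive right_kspace_scale +%R.
Proof. by move=> a s t; apply: scalerDr. Qed.
Fact right_kspace_scaleDl m : {morph right_kspace_scale^~ m : a b / a + b}.
Proof.
by move=> a b; rewrite /right_kspace_scale scalerDl; apply: scalerDl.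
Qed.
HB.instance Definition _ :=
  GRing.Zmodule_isLmodule.Build k (right_kspace M)
    right_kspace_scaleA right_kspace_scale1
    right_kspace_scaleDr right_kspace_scaleDl.

End RightSpace.

(** * From Hom(U, tau U) = 0 to Ext^1(U, Fac U) = 0 *)

Section Tau.
Variables (k : fieldType) (L : falgType k).
Implicit Types (A B C M N P : lmodType L^c) (T : lmodType L).

(* Hom(A, D T) is the k-dual of the cokernel of Hom(P0, A) -> Hom(P1, A): a
   functional xi on Hom(P1, A) killing the image of Hom(P0, A) defines a map
   a |-> (f |-> xi (x |-> a (f x))) from A to D T. *)
Lemma factor_presentation (P0 P1 : lmodType L^c) (d : {linear P1 -> P0}) T
    (q : {linear ring_dual P1 -> T}) A :
  fingen P1 -> projective P1 -> exact (ring_dual_map d) q -> surjective q ->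
  (forall (f : {linear A -> field_dual T}) a, f a = 0) ->
  forall s : {linear P1 -> A}, exists t : {linear P0 -> A}, forall x, t (d x) = s x.
Proof.
move=> P1fg P1proj dq qS homA0 s; have [n [e [e' eE]]] := dual_basis P1fg P1proj.
(* Hom(P1, A) embeds in V by evaluation at the e i. *)
pose V := {ffun 'I_n -> right_kspace A}.
(* [W] is the image of Hom(P0, A) in [V]. It is a k-subspace because the scalars from [k] are
   central in [L] and so act on [A] by module endomorphisms. *)
pose W (v : V) := exists t : {linear P0 -> A}, forall i, v i = t (d (e i)).
have W0 : W 0 by exists \0 => i; rewrite ffunE.
have central (c : k) (a : L) : a * c%:A = c%:A * a.
  by rewrite -scalerAl mul1r -scalerAr mulr1.
have scale_linear (c : k) (t : {linear P0 -> A}) :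
    linear (fun y => ((c%:A : L) : L^c) *: t y).
  move=> a x y; rewrite linearP scalerDr !scalerA; congr (_ *: _ + _).
  exact: central.
have WP c x y : W x -> W y -> W (c *: x + y).
  move=> [t tE] [u uE]; exists (mk_linear (scale_linear c t) \+ u) => i.
  by rewrite !ffunE /= -uE -tE.
pose vs : V := [ffun i => s (e i)].
have [[t tE] | nWs] := pselect (W vs).
  exists t => x; rewrite [x]eE !linear_sum; apply: eq_bigr => i _.
  by rewrite !linearZ; have := tE i; rewrite ffunE /= => ->.
(* From here on the goal is that [xi] vanishes at [vs], a contradiction. Below, [phi a f] is the
   value of [xi] at the map P1 -> A sending x to a . f x. *)
have [xi [xiW xis]] := separating_functional W0 WP nWs; case: xis.
pose phi (a : A) (f : ring_dual P1) : k^o := xi [ffun i => (f (e i) : L^c) *: a].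
have phi_linear a c f g : phi a (c%:A *: f + g) = c *: phi a f + phi a g.
  rewrite /phi -linearP; congr (xi _); apply/ffunP => i; rewrite !ffunE.
  have E (x y : L^c) : (((c%:A : L) * (x : L) : L) : L^c) *: a + y *: a =
      ((c%:A : L) : L^c) *: (x *: a) + y *: a.
    by rewrite scalerA; congr (_ *: a + _); rewrite -central.
  exact: etrans (scalerDl a _ _) (E _ _).
have phi_linearl f (c : L) a b :
    phi ((c : L^c) *: a + b) f = phi a (c *: f) + phi b f.
  rewrite /phi -linearD; congr (xi _); apply/ffunP => i; rewrite !ffunE.
  by rewrite scalerDr scalerA.
(* If [q] kills [f], then [f] is some [g] composed with [d], so the associated vector lies in [W].
   Hence [phi a] descends to [T]. *)
have phi0 a f : q f = 0 -> phi a f = 0.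
  move=> /dq[g <-]; apply: xiW.
  have t_linear : linear (fun y => (g y : L^c) *: a).
    by move=> b x y; rewrite linearP scalerDl -scalerA.
  by exists (mk_linear t_linear) => i; rewrite ffunE.
have [r qr] := choice qS.
have phi_q a f g : q f = q g -> phi a f = phi a g.
  move=> fg; apply/eqP; rewrite -subr_eq0; apply/eqP.
  have := phi_linear a (-1) g f; rewrite scaleN1r => E.
  by rewrite addrC -scaleN1r -E phi0 // linearP fg !scaleN1r addNr.
have psi_linear a : linear (fun t : kspace T => phi a (r t)).
  by move=> c t u; rewrite -phi_linear; apply: phi_q; rewrite qr linearP !qr.
have Phi_linear : linear (fun a => mk_linear (psi_linear a) : field_dual T).
  move=> c a b; apply: linear_ext => t.
  apply: etrans (phi_linearl _ _ _ _) _; congr (_ + _).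
  by apply: phi_q; rewrite linearZ /= !qr.
have phi_eq0 a f : phi a f = 0.
  have /(congr1 (fun h : {linear kspace T -> k^o} => h (q f))) :=
    homA0 (mk_linear Phi_linear) a.
  by move=> E; rewrite -[RHS]E; apply: phi_q; rewrite qr.
(* By the dual basis, [s] is the sum of the maps sending x to s (e i) . e' i x, and [xi] takes the
   value [phi (s (e i)) (e' i)] on each of them. *)
suff -> : vs = \sum_(i < n) [ffun j => (e' i (e j) : L^c) *: s (e i)].
  by rewrite linear_sum big1 // => i _; apply: (phi_eq0 (s (e i)) (e' i)).
apply/ffunP => j; rewrite sum_ffunE ffunE {1}(eE (e j)) linear_sum.
by apply: eq_bigr => i _; rewrite linearZ ffunE.
Qed.

(** A lift [h0] of [h \o p] to P0 sends the image of [d] into [A], which defines [s] on P1.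
    Extending [s] along [d] to [t] and subtracting [f \o t] from [h0] makes the lift vanish on the
    image of [d], so it descends to [U]; the correction is invisible in [C]. *)
Lemma tau_rigid_lift U A B C (f : {linear A -> B}) (g : {linear B -> C}) :
  fingen U -> tau_rigid U -> short_exact f g -> cok 0 U A ->
  forall h : {linear U -> C}, exists h' : {linear U -> B}, forall u, g (h' u) = h u.
Proof.
move=> Ufg [N [[T [[P0 [P1 [d [p [q [mpp dq qS]]]]]] DTN]] homUN0]] [fI fg gS] cA h.
have [[_ P0proj] [P1fg P1proj] [dp pS] _ _] := mpp.
have homADT0 (u : {linear A -> field_dual T}) a : u a = 0.
  have [i [j [iK _]]] := isomorphic_inv DTN.
  by have /= E := hom_cok0_eq0 Ufg homUN0 cA (i \o u) a; rewrite -[LHS]iK E linear0.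
have [h0 gh0] := P0proj _ _ g (h \o p) gS.
have [|s fs] := @factor_inj _ _ _ _ f (h0 \o d) fI.
  by move=> x; apply/fg; rewrite gh0 /= (dp _).2 ?linear0 //; exists x.
have [t td] := factor_presentation P1fg P1proj dq qS homADT0 s.
have [|h' h'p] := @factor_surj _ _ _ _ p (h0 \- (f \o t)) pS.
  by move=> y /dp[x <-]; rewrite /= td fs subrr.
exists h' => u; have [y <-] := pS u; rewrite h'p linearB gh0 /=.
by rewrite [X in _ - X](fg _).2 ?subr0 //; exists (t y).
Qed.

End Tau.

Theorem proposition1p7 (k : closedFieldType) (Lambda : falgType k)
    (U : lmodType Lambda^c) (U_fingen : fingen U) (U_rigid : tau_rigid U)
    (n : nat) :
  fold_torsion_class n.+1 (cok n U).
Proof.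
apply: cok_fold_torsion_class => // A B C f g fg cA h.
exact: tau_rigid_lift U_fingen U_rigid fg cA h.
Qed.
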